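(* Let $G$ be a directed graph (loops allowed) on vertex set $\{v_1,\dots,v_N\}$, let $i,j\in\{1,\dots,N\}$ and let $h\neq 1$ be a hike from $v_i$ to $v_j$. Then $$f_{ij}(h)=\sum_{s_1\cdots s_k\,p=h}(-1)^{n'(s_1)+\cdots+n'(s_k)+n'(p)},$$ where $n'(\cdot)=n(\cdot)+1$ and the sum is taken over all self-avoiding decompositions of $h$, i.e. all ordered $(k+1)$-tuples $(s_1,\dots,s_k,p)$ with $k\ge0$, each $s_r$ a non-empty self-avoiding closed hike, and $p\in\mathcal S_{ij}$, such that $s_1\cdots s_k\,p=h$.
   Context: Edges are identified with formal variables $\omega_{ij}$ (edge from $v_i$ to $v_j$). A walk of length $\ell$ from $v_i$ to $v_j$ is a succession of contiguous edges $\omega_{ii_1}\cdots\omega_{i_{\ell-1}j}$, identified with the monomial of its edges (same edges with multiplicity means same walk); it is simple if its vertices are pairwise distinct except possibly $i=j$ for closed walks (loops and backtracks $\omega_{ij}\omega_{ji}$ are simple cycles). A hike from $v_i$ to $v_j$ is a monomial that is the product of a simple walk from $v_i$ to $v_j$ and simple cycles; a closed hike is a product of simple cycles (the empty product $1$ included); for $i=j$ the hikes from $v_i$ to $v_i$ are the closed hikes. $n(h)$ is the number of connected components of the subgraph formed by the edges of $h$, $V(h)$ its vertex set. A hike is self-avoiding if it crosses no vertex twice (a product of pairwise vertex-disjoint simple cycles and, if open, one simple path disjoint from them). $\mathcal S_{ij}$: for $i\ne j$, the set of self-avoiding hikes from $v_i$ to $v_j$; for $i=j$, the set of non-empty self-avoiding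 closed hikes $p$ with $v_i\in V(p)$. $f_{ij}(h)$: if $h$ is a walk of length $\ell$, the number of ways to write $h$ as a succession of contiguous edges starting at $v_i$ and ending at $v_j$ (the coefficient of the monomial $h$ in the $(i,j)$ entry of $\mathsf{W}^\ell$, where $\mathsf W=(\omega_{ij})$); $f_{ij}(h)=0$ if $h$ is not connected. *)

(* Defs.v *)
From mathcomp Require Import all_boot all_order all_algebra.
From mathcomp Require Import finmap.
From mathcomp.multinomials Require Export monalg.
From mathcomp Require Export classical_sets cardinality fsbigop.

Set Implicit Arguments.
Unset Strict Implicit.
Unset Printing Implicit Defensive.

(* The pair (a, b) stands for the variable omega_ab; it is an edge of the
   graph given by the relation G : rel 'I_N exactly when G a b. *)
Notation edge N := ('I_N * 'I_N)%type.

(* Finitely supported exponents, written multiplicatively (scope %M). *)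
Notation monom N := {cmonom (edge N)}.

Local Notation "x * y" := (mmul x y) : monom_scope.

Fixpoint walk N (G : rel 'I_N) (i j : 'I_N) (w : seq (edge N)) : bool :=
  if w is a :: w' then [&& a.1 == i, G a.1 a.2 & walk G a.2 j w'] else i == j.

Definition monom_of N (w : seq (edge N)) : monom N :=
  \big[mmul/mone]_(a <- w) ucm a.

Definition monom_prod N (ws : seq (seq (edge N))) : monom N :=
  \big[mmul/mone]_(w <- ws) monom_of w.

(* For i = j the start point is the target of the last edge, so that it is
   already among the targets, once. *)
Definition simple_walk N (G : rel 'I_N) (i j : 'I_N) (w : seq (edge N)) : bool :=
  [&& w != [::], walk G i j w, uniq (map snd w)
    & (i != j) ==> (i \notin map snd w)].

Definition simple_cycle N (G : rel 'I_N) (w : seq (edge N)) : bool :=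
  [exists i, simple_walk G i i w].

Definition closed_hike N (G : rel 'I_N) (h : monom N) : Prop :=
  exists2 cs : seq (seq (edge N)), all (simple_cycle G) cs & h = monom_prod cs.

Definition open_hike N (G : rel 'I_N) (i j : 'I_N) (h : monom N) : Prop :=
  exists w : seq (edge N), exists cs : seq (seq (edge N)),
    [/\ simple_walk G i j w, all (simple_cycle G) cs
      & h = (monom_of w * monom_prod cs)%M].

Definition hike N (G : rel 'I_N) (i j : 'I_N) (h : monom N) : Prop :=
  if i == j then closed_hike G h else open_hike G i j h.

Definition walk_vertices N (w : seq (edge N)) : {set 'I_N} :=
  [set v | (v \in map fst w) || (v \in map snd w)].

Definition vertex_disjoint N (ws : seq (seq (edge N))) : bool :=
  pairwise (fun w w' => [disjoint walk_vertices w & walk_vertices w']) ws.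

Definition self_avoiding_closed N (G : rel 'I_N) (h : monom N) : Prop :=
  exists cs : seq (seq (edge N)),
    [/\ all (simple_cycle G) cs, vertex_disjoint cs & h = monom_prod cs].

(* Only used for i != j. *)
Definition self_avoiding_open N (G : rel 'I_N) (i j : 'I_N) (h : monom N) :
    Prop :=
  exists w : seq (edge N), exists cs : seq (seq (edge N)),
    [/\ simple_walk G i j w, all (simple_cycle G) cs, vertex_disjoint (w :: cs)
      & h = (monom_of w * monom_prod cs)%M].

Definition vertices N (h : monom N) : {set 'I_N} :=
  [set v | [exists u, (0 < h (v, u)) || (0 < h (u, v))]].

Definition adjacent N (h : monom N) : rel 'I_N :=
  fun u v => (0 < h (u, v)) || (0 < h (v, u)).

Definition ncc N (h : monom N) : nat := n_comp (adjacent h) (vertices h).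

Definition ncc' N (h : monom N) : nat := (ncc h).+1.

Definition self_avoiding_hikes N (G : rel 'I_N) (i j : 'I_N) : set (monom N) :=
  [set p | if i == j
           then [/\ p <> mone, self_avoiding_closed G p & i \in vertices p]
           else self_avoiding_open G i j p]%classic.

(* A decomposition (s_1, ..., s_k, p) is the pair ([:: s_1; ...; s_k], p). *)
Definition decompositions N (G : rel 'I_N) (i j : 'I_N) (h : monom N) :
    set (seq (monom N) * monom N) :=
  [set d | [/\ forall s, s \in d.1 -> s <> mone /\ self_avoiding_closed G s,
               self_avoiding_hikes G i j d.2
             & ((\big[mmul/mone]_(s <- d.1) s) * d.2)%M = h]]%classic.

(* A walk with monomial h has length mdeg h, and a monomial that is not
   connected is not the monomial of any walk, so it gets the value 0. *)
Definition walk_count N (G : rel 'I_N) (i j : 'I_N) (h : monom N) : nat :=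
  #|[set w : (mdeg h).-tuple (edge N) |
      walk G i j w && (monom_of w == h)]|.

(* \sum_(d \in A) is 0 by convention when infinitely many terms are nonzero;
   this does not happen for A := decompositions G i j h. *)
Lemma finite_decompositions N (G : rel 'I_N) (i j : 'I_N) (h : monom N) :
  finite_set (decompositions G i j h).
Proof.
pose m := mdeg h; pose T := {ffun edge N -> 'I_m.+1}.
pose g (f : T) : monom N := [cmonom nat_of_ord (f e) | e in [fset e | e : edge N]%fset]%M.
have gE x : mdeg x <= m -> exists f, g f = x.
  move=> le_xm; exists [ffun e => inord (x e)]; apply/eqP/cmP => e.
  rewrite /g cmE fsfunE in_imfset //= ffunE inordK // ltnS (leq_trans _ le_xm) //.
  rewrite mdegE; case: (boolP (e \in finsupp x)) => [ex|/fsfun_dflt ->] //.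
  by rewrite (big_fsetD1 e) //= leq_addr.
pose F (b : m.-bseq T * T) := (map g b.1, g b.2).
apply: (@sub_finite_set _ _ (F @` setT)%classic); last exact/finite_image/finite_finset.
case=> s p [/= sP _ defh].
have degh : m = (\sum_(x <- s) mdeg x + mdeg p)%N.
  by rewrite /m -defh mdegM mdeg_prod.
have [t st] : exists t : seq T, map g t = s.
  have : forall x, x \in s -> mdeg x <= m.
    by move=> x xs; rewrite degh (big_rem x) //= -addnA leq_addr.
  elim: s {sP defh degh} => [|x s IHs] le_sm; first by exists [::].
  have [t <-] := IHs (fun y ys => le_sm y (mem_behead (s := x :: s) ys)).
  by have [f <-] := gE x (le_sm x (mem_head _ _)); exists (f :: t).
have szt : size t <= m.
  rewrite -(size_map g) st degh -sum1_size (leq_trans _ (leq_addr _ _)) //.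
  rewrite big_seq [leqRHS]big_seq leq_sum // => x /sP[x1 _].
  by rewrite lt0n mdeg_eq0; apply/eqP.
have [f fp] : exists f, g f = p by apply: gE; rewrite degh leq_addl.
by exists (Bseq szt, f) => //; rewrite /F /= st fp.
Qed.

(* Main.v *)
(** Put W = (omega_ij) over the edges of G and D = det(1 - W).  Expanding D over
    pairs (permutation, subset containing its support) shows that D is the sum of
    (-1)^n(s) s over the self-avoiding closed hikes s, and expanding the cofactors
    in the same way that adj(1 - W)_ij - delta_ij D is the sum of (-1)^n'(p) p over
    S_ij.  Cramer's rule turns (1 - W)^-1 = 1 + W + W^2 + ... into
      D * (generating function of non-empty walks from i to j)
        = sum over S_ij of (-1)^n'(p) p,
    and expanding D^-1 as the geometric series in 1 - D, the sum of (-1)^n'(s) s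
    over the non-empty self-avoiding closed hikes, gives the formula.  As the
    computation takes place among polynomials, all series are truncated at the
    degree of h. *)

Require Import Defs.
From mathcomp Require Import all_boot all_order all_algebra all_fingroup finmap.
Import GRing.Theory.
Local Open Scope ring_scope.
Set Implicit Arguments.
Unset Strict Implicit.
Unset Printing Implicit Defensive.

(** * Self-avoiding hikes as permutations *)

Local Notation "x * y" := (mmul x y) : monom_scope.

(** A vertex of a self-avoiding hike has at most one outgoing and at most one incoming edge, so the
    hike is the graph of a permutation [s] restricted to the set [U] of its sources. *)
Definition perm_monom N (s : 'S_N) (U : {set 'I_N}) : {cmonom (edge N)} :=
  \big[mmul/mone]_(x in U) ucm (x, s x).

Lemma perm_monomE N (s : 'S_N) (U : {set 'I_N}) x y :
  perm_monom s U (x, y) = ((x \in U) && (s x == y)) :> nat.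
Proof.
have -> : perm_monom s U (x, y) = (\sum_(z in U) ((z, s z) == (x, y)))%N.
  rewrite /perm_monom; elim/big_rec2: _ => [|z n m _ <-]; first by rewrite cm1.
  by rewrite cmM cmU.
case: (boolP (x \in U)) => [xU|xU] /=.
  rewrite (bigD1 x) //= big1 ?addn0 ?xpair_eqE ?eqxx // => z /andP[_ zx].
  by rewrite xpair_eqE (negbTE zx).
rewrite big1 // => z zU; rewrite xpair_eqE; case: eqP => // zx.
by rewrite -zx zU in xU.
Qed.

Lemma perm_monom_gt0 N (s : 'S_N) (U : {set 'I_N}) x y :
  (0 < perm_monom s U (x, y))%N = (x \in U) && (s x == y).
Proof. by rewrite perm_monomE lt0b. Qed.

Lemma perm_monomU N (s : 'S_N) (U V : {set 'I_N}) :
  [disjoint U & V] ->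
  perm_monom s (U :|: V) = (perm_monom s U * perm_monom s V)%M.
Proof.
by move=> dUV; rewrite /perm_monom -bigU //=; apply: eq_bigl => x; rewrite !inE.
Qed.

Lemma monom_of_perm N (s : 'S_N) (E : seq (edge N)) :
  uniq (map fst E) -> {in E, forall e, s e.1 = e.2} ->
  monom_of E = perm_monom s [set x in map fst E].
Proof.
move=> uE sE; have -> : monom_of E = \big[mmul/mone]_(x <- map fst E) ucm (x, s x).
  rewrite big_map /monom_of; apply: eq_big_seq => -[x y] /sE /= ->.
  by [].
by rewrite big_uniq //=; apply: eq_bigl => x; rewrite inE.
Qed.

Lemma monom_of_flatten N (cs : seq (seq (edge N))) :
  monom_of (flatten cs) = monom_prod cs.
Proof.
by rewrite /monom_prod; elim: cs => [|c cs IHcs];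
  rewrite ?big_nil ?big_cons -?IHcs /monom_of ?big_nil ?big_cat.
Qed.

(** Such an edge list is the graph of a permutation of its set of sources, that is, a disjoint union
    of cycles. *)
Definition balanced N (E : seq (edge N)) :=
  uniq (map snd E) && perm_eq (map fst E) (map snd E).

Lemma uniq_map_inj (T1 T2 : eqType) (f : T1 -> T2) (s : seq T1) :
  uniq (map f s) -> {in s &, injective f}.
Proof.
elim: s => //= a s IHs /andP[fa us] x y; rewrite !inE.
move=> /predU1P[->|xs] /predU1P[->|ys] // fxy; last exact: IHs.
- by rewrite fxy map_f in fa.
- by rewrite -fxy map_f in fa.
Qed.

(** Sending each source to the target of the only edge leaving it is injective, because no target is
    repeated, and it preserves the set of sources; elsewhere the permutation is the identity. *)
Lemma balanced_perm N (E : seq (edge N)) :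
  balanced E -> exists2 s : 'S_N,
    perm_on [set x in map fst E] s & {in E, forall e, s e.1 = e.2}.
Proof.
case/andP=> uE2 pE; have uE1 : uniq (map fst E) by rewrite (perm_uniq pE).
set A := [set x in map fst E].
pose f x := if [pick e in E | e.1 == x] is Some e then e.2 else x.
have fE e : e \in E -> f e.1 = e.2.
  move=> eE; rewrite /f; case: pickP => [e' /andP[e'E /eqP ee']|/(_ e)].
    by rewrite (uniq_map_inj uE1 e'E eE ee').
  by rewrite /= eE eqxx.
have AE x : x \in A -> exists2 e, e \in E & x = e.1 by rewrite inE => /mapP.
have injf : {in A &, injective f}.
  move=> x y /AE[e eE ->] /AE[e' e'E ->]; rewrite !fE // => ee'.
  by rewrite (uniq_map_inj uE2 eE e'E ee').
have fA : [set f x | x in A] \subset A.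
  apply/fintype.subsetP => _ /imsetP[x /AE[e eE ->] ->].
  by rewrite fE // inE (perm_mem pE) map_f.
exists (perm_in injf fA); first exact: perm_in_on.
by move=> e eE; rewrite perm_inE ?fE // inE map_f.
Qed.

Lemma balanced_flatten N (cs : seq (seq (edge N))) :
  all (@balanced N) cs -> vertex_disjoint cs -> balanced (flatten cs).
Proof.
rewrite /vertex_disjoint; elim: cs => //= c cs IHcs /andP[/andP[uc pc] bcs].
case/andP=> /allP dc /(IHcs bcs)/andP[ucs pcs].
rewrite /balanced !map_cat perm_cat // cat_uniq uc ucs !andbT /=.
apply/hasPn => v /mapP[e /flattenP[c' c'cs ec'] ->].
apply: contraL (dc _ c'cs) => ec; apply/pred0Pn; exists e.2.
by rewrite /= !inE ec (map_f snd ec') !orbT.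
Qed.

(** Both sides list the visited vertices in order; for a closed walk, sources and targets therefore
    agree as multisets. *)
Lemma walk_rcons N (G : rel 'I_N) i j w :
  walk G i j w -> i :: map snd w = rcons (map fst w) j.
Proof. by elim: w i => [i /eqP->|a w IHw i /= /and3P[/eqP<- _ /IHw->]]. Qed.

Lemma walk_edges N (G : rel 'I_N) i j w :
  walk G i j w -> {in w, forall e, G e.1 e.2}.
Proof.
elim: w i => //= a w IHw i /and3P[_ Ga /IHw{}IHw] e.
by rewrite inE => /predU1P[->|/IHw].
Qed.

Lemma simple_cycle_balanced N (G : rel 'I_N) w : simple_cycle G w -> balanced w.
Proof.
case/existsP=> i /and4P[_ /walk_rcons wi uw _]; rewrite /balanced uw /=.
by rewrite -(perm_cons i) wi perm_sym perm_rcons perm_refl.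
Qed.

Lemma simple_cycle_edges N (G : rel 'I_N) w :
  simple_cycle G w -> {in w, forall e, G e.1 e.2}.
Proof. by case/existsP=> i /and4P[_ /walk_edges]. Qed.

(* Closing an open simple path by the edge from j to i, whether or not it lies
   in G, reduces open hikes to closed ones. *)
Lemma simple_path_balanced N (G : rel 'I_N) i j w :
  i != j -> simple_walk G i j w -> balanced ((j, i) :: w).
Proof.
move=> ij /and4P[_ /walk_rcons wi uw]; rewrite ij /= => iw.
by rewrite /balanced /= iw uw /= wi perm_sym perm_rcons perm_refl.
Qed.
(** A fixed point of [s] in [U] is a loop of the hike, one outside [U] is a vertex off the hike; [s]
    alone would not tell them apart. *)
Definition cover_perm N (G : rel 'I_N) (s : 'S_N) (U : {set 'I_N}) :=
  perm_on U s && [forall x in U, G x (s x)].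

(* An open self-avoiding hike becomes a permutation once j is sent to i; the
   corresponding edge is not part of the hike. *)
Definition link_perm N (G : rel 'I_N) i j (s : 'S_N) (U : {set 'I_N}) :=
  [&& j \notin U, s j == i, perm_on (j |: U) s & [forall x in U, G x (s x)]].

(** * Cycles and paths traced out by a permutation *)

Definition perm_walk N (s : 'S_N) x n : seq (edge N) :=
  [seq (y, s y) | y <- traject s x n].

Lemma walk_perm_walk N (G : rel 'I_N) (s : 'S_N) x n :
  {in traject s x n, forall y, G y (s y)} ->
  walk G x (iter n s x) (perm_walk s x n).
Proof.
elim: n x => [|n IHn] x Gs /=; first exact: eqxx.
rewrite eqxx Gs ?mem_head //= -iterS iterSr; apply: IHn => y ys.
by apply: Gs; rewrite inE ys orbT.
Qed.

Lemma perm_walk_snd N (s : 'S_N) x n : map snd (perm_walk s x n) = traject s (s x) n.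
Proof. by elim: n x => //= n IHn x; rewrite -(IHn (s x)). Qed.

Lemma perm_walk_fst N (s : 'S_N) x n : map fst (perm_walk s x n) = traject s x n.
Proof. by rewrite /perm_walk -map_comp -[RHS]map_id. Qed.

Lemma monom_of_perm_walk N (s : 'S_N) x n :
  uniq (traject s x n) ->
  monom_of (perm_walk s x n) = perm_monom s [set y in traject s x n].
Proof.
move=> us; rewrite (@monom_of_perm _ s) ?perm_walk_fst //.
by move=> e /mapP[y _ ->].
Qed.

Lemma porbit_step (T : finType) (s : {perm T}) x : porbit s (s x) = porbit s x.
Proof. by have := porbit_perm s 1 x; rewrite expg1. Qed.

Lemma sub_porbit (T : finType) (s : {perm T}) (U : {set T}) x :
  {in U, forall y, s y \in U} -> x \in U -> porbit s x \subset U.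
Proof.
move=> sU xU; apply/fintype.subsetP => _ /porbitP[n ->].
by elim: n => [|n IHn]; rewrite ?expg0 ?perm1 // expgSr permM sU.
Qed.

Lemma setD_porbit_step (T : finType) (s : {perm T}) (U : {set T}) x :
  {in U, forall y, s y \in U} ->
  {in U :\: porbit s x, forall y, s y \in U :\: porbit s x}.
Proof.
move=> sU y /setDP[yU yx]; rewrite inE sU // andbT.
by rewrite -eq_porbit_mem porbit_step eq_porbit_mem.
Qed.

(** Induction on the size of [U]: the orbit of a point of [U] is traced by a simple cycle, and [s]
    still preserves the rest of [U]. Keeping track of the vertices makes the new cycle disjoint from
    the others. Since only stability of [U] is required, [s] may also move points outside [U], as
    happens for open hikes. *)
Lemma perm_monom_cycles N (G : rel 'I_N) (s : 'S_N) (U : {set 'I_N}) :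
  {in U, forall y, s y \in U} -> {in U, forall y, G y (s y)} ->
  exists cs : seq (seq (edge N)),
    [/\ all (simple_cycle G) cs, vertex_disjoint cs,
        all (fun w => walk_vertices w \subset U) cs
      & perm_monom s U = monom_prod cs].
Proof.
have [n] := ubnP #|U|; elim: n U => // n IHn U ltU sU GU.
have [->|[x xU]] := set_0Vmem U.
  by exists [::]; split=> //; rewrite /perm_monom big_set0 /monom_prod big_nil.
have Ox : porbit s x \subset U by apply: sub_porbit.
have xO := porbit_id s x.
have [||y /setDP[/GU]//|cs [cyc dis sub defU]] := IHn (U :\: porbit s x).
- rewrite -ltnS (leq_trans _ ltU) // ltnS; apply: proper_card.
  by rewrite properE subsetDl; apply/subsetPn; exists x; rewrite // inE xO.
- exact: setD_porbit_step.
have OE : [set y in traject s x #|porbit s x|] = porbit s x.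
  by apply/setP => y; rewrite inE porbit_traject.
have wV : walk_vertices (perm_walk s x #|porbit s x|) \subset porbit s x.
  apply/fintype.subsetP => y; rewrite inE perm_walk_fst perm_walk_snd.
  rewrite -[in traject s (s x) _]porbit_step -!porbit_traject porbit_step.
  by rewrite orbb.
exists (perm_walk s x #|porbit s x| :: cs); split.
- rewrite /= cyc andbT; apply/existsP; exists x; apply/and4P; split.
  + rewrite -size_eq0 size_map size_traject -lt0n; apply/card_gt0P.
    by exists x.
  + rewrite -[in X in walk _ _ X _](iter_porbit s x).
    apply: walk_perm_walk => y; rewrite -porbit_traject => yO.
    exact: GU (fintype.subsetP Ox _ yO).
  + by rewrite perm_walk_snd -porbit_step uniq_traject_porbit.
  + by rewrite eqxx.
- rewrite /vertex_disjoint /= -/(vertex_disjoint _) dis andbT.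
  apply/allP => c ccs; have := allP sub c ccs; rewrite subsetD => /andP[_].
  by rewrite disjoint_sym; apply: disjointWl.
- rewrite /= (subset_trans wV) //=; apply/allP => c ccs.
  by apply: subset_trans (allP sub c ccs) _; rewrite subsetDl.
- rewrite /monom_prod big_cons -/(monom_prod _) -defU monom_of_perm_walk.
    rewrite OE -perm_monomU; last by rewrite -setI_eq0 setIDA setDIl setDv set0I.
    congr perm_monom; apply/setP => y; rewrite !inE.
    by case: (boolP (y \in porbit s x)) => //= /(fintype.subsetP Ox)->.
  exact: uniq_traject_porbit.
Qed.

(** Concatenating disjoint cycles gives a balanced edge list, hence a permutation; conversely, the
    orbits inside [U] give the cycles. *)
Lemma self_avoiding_closedP N (G : rel 'I_N) h :
  self_avoiding_closed G h <->
  exists s U, cover_perm G s U /\ h = perm_monom s U.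
Proof.
split=> [[cs [cyc dis ->]]|[s [U [/andP[onU GU] ->]]]].
  have bal : balanced (flatten cs).
    by apply: balanced_flatten dis; apply: sub_all cyc => w /simple_cycle_balanced.
  have [s ons sE] := balanced_perm bal.
  have /andP[uE pE] := bal.
  exists s, [set x in map fst (flatten cs)].
  rewrite -monom_of_perm ?monom_of_flatten ?(perm_uniq pE) //; split=> //.
  rewrite /cover_perm ons; apply/forall_inP => _ /[!inE] /mapP[e ecs ->].
  rewrite sE //; case/flattenP: ecs => c ccs ec.
  exact: simple_cycle_edges (allP cyc c ccs) _ ec.
have [||cs [cyc dis _ ->]] := @perm_monom_cycles _ G s U.
- by move=> y; rewrite perm_closed.
- by apply/forall_inP.
- by exists cs.
Qed.

(** Adding the edge from [j] to [i] turns the path into a cycle, and the closed argument applies.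
    Conversely, the orbit of [j], cut open at [j], is the path, and the other orbits in [U] are the
    cycles. *)
Lemma self_avoiding_openP N (G : rel 'I_N) i j h : i != j ->
  self_avoiding_open G i j h <->
  exists s U, link_perm G i j s U /\ h = perm_monom s U.
Proof.
move=> ij; split=> [[w [cs [sw cyc dis ->]]]|];
  last case=> s [U [/and4P[jU /eqP sj onU /forall_inP GU] ->]].
  have /and4P[_ wij _ _] := sw.
  have bal : balanced (flatten (((j, i) :: w) :: cs)).
    apply: balanced_flatten => /=.
      rewrite (simple_path_balanced ij sw); apply: sub_all cyc => c.
      exact: simple_cycle_balanced.
    case/andP: dis => wcs dis; apply/andP; split=> //.
    (* The closing edge brings no new vertex, so disjointness from the cycles is kept. *)
    have <- // : walk_vertices w = walk_vertices ((j, i) :: w).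
    have := walk_rcons wij; case: w {wcs wij} sw => [/and4P[]//|e w _] wi.
    have jw : j \in i :: map snd (e :: w) by rewrite wi mem_rcons mem_head.
    have e1 : e.1 = i by case: wi.
    move: jw; rewrite inE eq_sym (negbTE ij) => /= jw.
    apply/setP => v; rewrite !in_set !map_cons !in_cons e1 [(j, i).1]/= [(j, i).2]/=.
    case: (eqVneq v i) => [->|_]; rewrite ?orbT //=.
    by case: (eqVneq v j) => [->|_] //=; rewrite -in_cons jw orbT.
  have [s ons sE] := balanced_perm bal.
  have /andP[uE pE] := bal.
  move: ons uE pE sE; rewrite /= -cat_cons => ons uE pE sE.
  set E := w ++ flatten cs in ons uE pE sE.
  have uE1 : uniq (j :: map fst E) by rewrite (perm_uniq pE).
  have {uE1} /andP[jE uE1] := uE1.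
  exists s, [set x in map fst E]; split; last first.
    rewrite -monom_of_perm //; last by move=> e eE; apply: sE; rewrite inE eE orbT.
    by rewrite /monom_of big_cat -!/(monom_of _) monom_of_flatten.
  have GE : {in E, forall e, G e.1 e.2}.
    move=> e; rewrite mem_cat => /orP[/(walk_edges wij)//|/flattenP[c ccs ec]].
    exact: simple_cycle_edges (allP cyc c ccs) _ ec.
  apply/and4P; split; first by rewrite inE.
  - by apply/eqP/(sE (j, i)); rewrite mem_head.
  - apply: etrans ons; congr (perm_on _ s); apply/setP => v.
    by rewrite !inE.
  - apply/forall_inP => _ /[!inE] /mapP[e eE ->].
    by rewrite sE ?GE // inE eE orbT.
set O := porbit s j.
have jV : j \in j |: U by rewrite setU11.
have sV : {in j |: U, forall y, s y \in j |: U} by move=> y; rewrite perm_closed.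
have OV : O \subset j |: U by apply: sub_porbit.
have VO : (j |: U) :\: O \subset U.
  apply/fintype.subsetP => y; rewrite !inE => /andP[yO /predU1P[yj|//]].
  by rewrite yj porbit_id in yO.
have [||cs [cyc dis sub mcs]] := @perm_monom_cycles _ G s ((j |: U) :\: O).
- exact: setD_porbit_step.
- by move=> y /(fintype.subsetP VO)/GU.
(* The orbit of [j] has [n.+1] elements; the path starts at [i = s j] and has [n] edges, whose
   sources are all of the orbit but [j]. *)
have [n On] : exists n, #|O| = n.+1.
  by exists #|O|.-1; rewrite prednK //; apply/card_gt0P; exists j; apply: porbit_id.
have tO : traject s j n.+1 =i O by move=> y; rewrite porbit_traject -On.
have ut : uniq (traject s j n.+1) by rewrite -On uniq_traject_porbit.
have it : iter n s i = j by rewrite -sj -iterSr -On iter_porbit.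
have /andP[jt uti] : (j \notin traject s i n) && uniq (traject s i n).
  by move: ut; rewrite /= sj.
have Oj : [set y in traject s i n] = O :\ j.
  apply/setP => y; rewrite !inE -tO /= inE sj.
  by case: eqVneq => //= ->; apply: negbTE.
have wV : walk_vertices (perm_walk s i n) \subset O.
  apply/fintype.subsetP => y; rewrite inE perm_walk_fst perm_walk_snd -tO /= sj.
  rewrite inE; case/orP=> [->|]; first by rewrite orbT.
  move=> yt; have : y \in traject s i n.+1 by rewrite inE yt orbT.
  by rewrite trajectSr it mem_rcons inE.
have utj : uniq (traject s i n.+1) by rewrite trajectSr it rcons_uniq jt.
exists (perm_walk s i n), cs; split=> //.
- apply/and4P; split.
  + rewrite -size_eq0 size_map size_traject; apply: contraNneq ij => n0.
    by rewrite -it n0.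
  + rewrite -[X in walk _ _ X _]it; apply: walk_perm_walk => y yt.
    apply: GU; have : y \in j |: U.
      by apply: (fintype.subsetP OV); rewrite -tO inE sj yt orbT.
    by rewrite !inE => /predU1P[yj|//]; rewrite -yj yt in jt.
  + by rewrite perm_walk_snd; case/andP: utj.
  + by rewrite ij perm_walk_snd; case/andP: utj.
- rewrite /vertex_disjoint /= -/(vertex_disjoint _) dis andbT.
  apply/allP => c ccs; have := allP sub c ccs; rewrite subsetD => /andP[_].
  by rewrite disjoint_sym; apply: disjointWl.
- rewrite -mcs monom_of_perm_walk // Oj -perm_monomU; last first.
    rewrite -setI_eq0; apply/eqP/setP => y; rewrite !inE.
    by case: (y \in O); rewrite ?andbF.
  congr perm_monom; apply/setP => y; rewrite !inE.
  case: (eqVneq y j) => [->|yj] /=; first by rewrite porbit_id (negbTE jU).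
  case: (boolP (y \in O)) => //= yO.
  by have := fintype.subsetP OV y yO; rewrite !inE (negbTE yj) /= => ->.
Qed.

(** * Signs and connected components *)

Lemma perm_monom_inj N (s t : 'S_N) (U V : {set 'I_N}) :
  perm_monom s U = perm_monom t V -> U = V /\ {in U, s =1 t}.
Proof.
move=> eq_m; have eqE x y : (x \in U) && (s x == y) = (x \in V) && (t x == y).
  by rewrite -!perm_monom_gt0 eq_m.
have sub x : x \in U -> x \in V /\ s x = t x.
  by move=> xU; have := eqE x (s x); rewrite xU eqxx => /esym/andP[-> /eqP->].
split=> [|x /sub[]//]; apply/setP => x; apply/idP/idP => [/sub[]//|xV].
by have := eqE x (t x); rewrite xV eqxx => /andP[].
Qed.

(** The monomial determines [U] and [s] on [U], and [s] is the identity elsewhere; sums over pairs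
    are thus sums over monomials without multiplicity. *)
Lemma cover_perm_monom_inj N (G : rel 'I_N) :
  {in [pred t : 'S_N * {set 'I_N} | cover_perm G t.1 t.2] &,
    injective (fun t => perm_monom t.1 t.2)}.
Proof.
move=> [s U] [t V] /andP[/= sU _] /andP[/= tV _] /perm_monom_inj[eUV st].
rewrite -eUV in tV *; congr (_, _); apply/permP => x.
by case: (boolP (x \in U)) => [/st//|xU]; rewrite !(@out_perm _ U).
Qed.

Lemma link_perm_monom_inj N (G : rel 'I_N) i j :
  {in [pred t : 'S_N * {set 'I_N} | link_perm G i j t.1 t.2] &,
    injective (fun t => perm_monom t.1 t.2)}.
Proof.
move=> [s U] [t V] /and4P[/= _ /eqP sj sU _] /and4P[/= _ /eqP tj tV _].
move=> /perm_monom_inj[eUV st]; rewrite -eUV in tV *; congr (_, _).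
apply/permP => x; case: (eqVneq x j) => [->|xj]; first by rewrite sj tj.
case: (boolP (x \in U)) => [/st//|xU].
by rewrite !(@out_perm _ (j |: U)) // !inE negb_or xj.
Qed.

(** Two vertices are connected in [h] exactly when they share an orbit of [s], so the roots of the
    components represent the orbits; each vertex off [h] is a fixed point and counts for one
    orbit. *)
Lemma card_porbits_ncc N (s : 'S_N) (h : {cmonom (edge N)}) :
  perm_on (vertices h) s -> (forall x, connect (adjacent h) x (s x)) ->
  (forall x y, (0 < h (x, y))%N -> s x = y) ->
  (#|porbits s| = ncc h + #|~: vertices h|)%N.
Proof.
move=> sh conn hs; set e := adjacent h.
have sym_e : connect_sym e.
  by apply: sym_connect_sym => x y; rewrite /e /adjacent orbC.
have connE x y : connect e x y = (porbit s x == porbit s y).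
  apply/idP/idP => [/connectP[p]|].
    elim: p x => [x _ ->//|z p IHp x /= /andP[exz /IHp{}IHp] /IHp/eqP<-].
    by case/orP: exz => /hs <-; rewrite porbit_step.
  rewrite eq_porbit_mem porbit_sym => /porbitP[n ->].
  elim: n => [|n IHn]; first by rewrite expg0 perm1 connect0.
  by rewrite expgSr permM (connect_trans IHn).
pose A := [set x | roots e x].
have -> : porbits s = porbit s @: A.
  apply/setP => O; apply/imsetP/imsetP => [[x _ ->]|[x _ ->]]; last by exists x.
  exists (fingraph.root e x); first by rewrite inE roots_root.
  by apply/eqP; rewrite -connE connect_root.
rewrite card_in_imset; last first.
  move=> x y; rewrite !inE => /eqP rx /eqP ry /eqP.
  by rewrite -connE => /(fingraph.rootP sym_e); rewrite rx ry.
rewrite -(cardsID (vertices h) A) /ncc; congr (_ + _)%N.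
  by apply: eq_card => x; rewrite !inE.
apply: eq_card => x; rewrite in_setD in_setC; case: (boolP (x \in vertices h)) => //= xh.
have := connect_root e x; rewrite connE eq_porbit_mem porbit_sym => /porbitP[n rx].
have rxx : fingraph.root e x = x.
  rewrite rx; elim: n {rx} => [|n IHn]; first by rewrite expg0 perm1.
  by rewrite expgSr permM IHn (out_perm sh).
by rewrite in_set /roots rxx eqxx.
Qed.

(* The orbits of s are the components of h together with the fixed points
   outside U. *)
Lemma perm_sign_ncc N (s : 'S_N) (U : {set 'I_N}) (h : {cmonom (edge N)}) :
  vertices h = U -> perm_on U s -> (forall x, connect (adjacent h) x (s x)) ->
  (forall x y, (0 < h (x, y))%N -> s x = y) ->
  (-1) ^+ (s : bool) * (-1) ^+ #|U| = (-1) ^+ ncc h :> int.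
Proof.
move=> <- sh conn hs; rewrite -(signr_odd _ #|_|) -(signr_odd _ (ncc h)) -signr_addb.
(* The parity of [s] is that of [N] plus the number of orbits; the vertices off [h] count in both
   terms and cancel. *)
congr (_ ^+ _); rewrite /odd_perm (card_porbits_ncc sh conn hs) -(cardsC (vertices h)).
by rewrite !oddD; do 3!case: (odd _).
Qed.

Lemma vertices_cover N (s : 'S_N) (U : {set 'I_N}) :
  perm_on U s -> vertices (perm_monom s U) = U.
Proof.
move=> sU; apply/setP => x; rewrite inE; apply/existsP/idP => [[y]|xU].
  rewrite !perm_monom_gt0 => /orP[/andP[]//|/andP[yU /eqP <-]].
  by rewrite perm_closed.
by exists (s x); rewrite perm_monom_gt0 xU eqxx.
Qed.

Lemma vertices_link N (s : 'S_N) (U : {set 'I_N}) i j :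
  i != j -> j \notin U -> s j = i -> perm_on (j |: U) s ->
  vertices (perm_monom s U) = j |: U.
Proof.
move=> ij jU sj sU; apply/setP => x; rewrite inE; apply/existsP/idP => [[y]|].
  rewrite !perm_monom_gt0 => /orP[/andP[xU _]|/andP[yU /eqP <-]].
    by rewrite !inE xU orbT.
  by rewrite perm_closed // !inE yU orbT.
case/setU1P=> [->|xU]; last by exists (s x); rewrite perm_monom_gt0 xU eqxx.
(* No edge leaves [j], so the edge entering it is used; its source lies in [U] because [s j = i]
   differs from [j]. *)
exists ((s^-1)%g j); rewrite !perm_monom_gt0 permKV eqxx andbT.
have : (s^-1)%g j \in j |: U by rewrite (perm_closed _ (perm_onV sU)) setU11.
case/setU1P=> [sjj|->]; last by rewrite orbT.
by rewrite -[X in s X]sjj permKV in sj; rewrite sj eqxx in ij.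
Qed.

Lemma perm_sign_cover N (s : 'S_N) (U : {set 'I_N}) :
  perm_on U s ->
  (-1) ^+ (s : bool) * (-1) ^+ #|U| = (-1) ^+ ncc (perm_monom s U) :> int.
Proof.
move=> sU; apply: perm_sign_ncc; rewrite ?vertices_cover // => x.
  case: (boolP (x \in U)) => xU; last by rewrite (out_perm sU xU) connect0.
  by apply: connect1; rewrite /adjacent perm_monom_gt0 xU eqxx.
by move=> y; rewrite perm_monom_gt0 => /andP[_ /eqP].
Qed.

(** The vertex set is [j |: U], one element more than [U]; the extra sign turns [ncc] into
    [ncc']. *)
Lemma perm_sign_link N (s : 'S_N) (U : {set 'I_N}) i j :
  i != j -> j \notin U -> s j = i -> perm_on (j |: U) s ->
  (-1) ^+ (s : bool) * (-1) ^+ #|U| = (-1) ^+ ncc' (perm_monom s U) :> int.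
Proof.
move=> ij jU sj sU; set h := perm_monom s U.
have step x : x != j -> connect (adjacent h) x (s x).
  move=> xj; case: (boolP (x \in U)) => xU.
    by apply: connect1; rewrite /adjacent perm_monom_gt0 xU eqxx.
  by rewrite (out_perm sU) ?connect0 // !inE negb_or xj.
have sym_h : connect_sym (adjacent h).
  by apply: sym_connect_sym => x y; rewrite /adjacent orbC.
(* The edge from j to i is absent from h, but the rest of its orbit leads from i
   to j. *)
have connj : connect (adjacent h) j (s j).
  rewrite sym_h sj; have : j \in porbit s i by rewrite -sj porbit_step porbit_id.
  case/porbitP=> n jE.
  suff : connect (adjacent h) i ((s ^+ n)%g i) \/ connect (adjacent h) i j.
    by rewrite -jE; case.
  elim: n {jE} => [|n [IHn|]]; [by left; rewrite expg0 perm1 connect0| |by right].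
  have [<-|nj] := eqVneq ((s ^+ n)%g i) j; first by right.
  by left; rewrite expgSr permM (connect_trans IHn) ?step.
have := @perm_sign_ncc _ s (j |: U) h; rewrite (vertices_link ij) // => /(_ erefl sU).
rewrite cardsU1 jU /ncc' add1n !exprS => <- => [||x y].
- by rewrite !mulN1r mulrN opprK.
- by move=> x; have [->|/step//] := eqVneq x j.
- by rewrite perm_monom_gt0 => /andP[_ /eqP].
Qed.

(** * Determinant and cofactors *)

Notation walk_alg N := {malg int[{cmonom (edge N)}]}.

Definition edge_mx N (G : rel 'I_N) : 'M[walk_alg N]_N :=
  \matrix_(a, b) if G a b then << ucm (a, b) >> else 0.

Lemma malgUM (K : monomType) (R : nzRingType) (a b : R) (m n : K) :
  << a *g m >> * << b *g n >> = << a * b *g mmul m n >>.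
Proof. by rewrite malgM_def fgmulUU. Qed.

Lemma malgU_sign (K : monomType) (R : nzRingType) n (a : R) (m : K) :
  << (-1) ^+ n * a *g m >> = (-1) ^+ n * << a *g m >>.
Proof.
rewrite -signr_odd -[in RHS]signr_odd; case: (odd n); last by rewrite !mul1r.
by rewrite expr1 expr1 !mulN1r monalgUN.
Qed.

Lemma malgUM1 N (m n : {cmonom (edge N)}) :
  << mmul m n >> = << m >> * << n >> :> walk_alg N.
Proof. by rewrite malgUM mul1r. Qed.

Lemma malgU_prod N (I : finType) (U : pred I) (F : I -> {cmonom (edge N)}) :
  << \big[mmul/mone]_(x | U x) F x >> = \prod_(x | U x) << F x >> :> walk_alg N.
Proof. by rewrite (big_morph _ (@malgUM1 N) (mpolyC1E _ _)). Qed.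

Lemma edge_mxE N (G : rel 'I_N) a b :
  edge_mx G a b = if G a b then << ucm (a, b) >> else 0.
Proof. by rewrite mxE. Qed.

Lemma prod_edge_mx N (G : rel 'I_N) (s : 'S_N) (U : {set 'I_N}) :
  {in U, forall x, G x (s x)} ->
  \prod_(x in U) edge_mx G x (s x) = << perm_monom s U >>.
Proof.
by move=> GU; rewrite malgU_prod; apply: eq_bigr => x xU; rewrite edge_mxE GU.
Qed.

(** Each factor is an identity entry plus an entry of [- edge_mx G]; [U] collects the rows where the
    latter is chosen, and [s] must fix the other rows of [P]. The determinant takes all rows for
    [P], a cofactor all but one. *)
Lemma prod_sub_edge_mx N (G : rel 'I_N) (s : 'S_N) (P : pred 'I_N) :
  \prod_(x | P x) (1 - edge_mx G) x (s x) =
    \sum_(U : {set 'I_N} | [&& [forall x in U, P x],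
        [forall (x | P x), (x \notin U) ==> (s x == x)]
        & [forall x in U, G x (s x)]]) << (-1) ^+ #|U| *g perm_monom s U >>.
Proof.
(* Outside [P] the two summands are 0 and 1, so that the product can run over all rows while only
   sets [U] inside [P] survive. *)
pose F x := if P x then - edge_mx G x (s x) else 0.
pose D x : walk_alg N := if P x then (s x == x)%:R else 1.
transitivity (\prod_x (F x + D x)).
  rewrite big_mkcond; apply: eq_bigr => x _; rewrite /F /D.
  by case: ifP => _; rewrite ?add0r // !mxE addrC eq_sym.
rewrite bigA_distr; apply: esym.
rewrite big_mkcond; apply: eq_big => [U|U _]; first by rewrite inE.
case: (boolP [forall x in U, P x]) => [/forall_inP UP|]; last first.
  case/forall_inPn=> x xU /negbTE Px.
  by rewrite (bigD1 x) //= xU /F Px mul0r.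
case: (boolP [forall (x | P x), (x \notin U) ==> (s x == x)])
  => [/forall_inP sP|]; last first.
  case/forall_inPn=> x Px; rewrite negb_imply => /andP[/negbTE xU /negbTE sx].
  by rewrite (bigD1 x) //= xU /D [P x]Px sx mul0r.
rewrite (bigID (mem U)) /= [X in _ * X]big1 ?mulr1 => [|x /negbTE xU]; last first.
  rewrite xU /D; case: ifP => // Px.
  by have := sP _ Px; rewrite xU => /= ->.
have -> : \prod_(x in U) (if x \in U then F x else D x) =
    \prod_(x in U) - edge_mx G x (s x).
  by apply: eq_bigr => x xU; rewrite xU /F UP.
rewrite prodrN; case: (boolP [forall x in U, G x (s x)]) => [/forall_inP GU|]; last first.
  case/forall_inPn=> x xU /negbTE Gx.
  by rewrite [X in _ * X](bigD1 x) //= edge_mxE Gx mul0r mulr0.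
by rewrite prod_edge_mx // -malgU_sign mulr1.
Qed.

(** * Signed sums over self-avoiding hikes *)

Definition closed_monoms N (G : rel 'I_N) : seq {cmonom (edge N)} :=
  map (fun t : 'S_N * {set 'I_N} => perm_monom t.1 t.2)
    (enum [pred t | cover_perm G t.1 t.2]).

Definition open_monoms N (G : rel 'I_N) i j : seq {cmonom (edge N)} :=
  map (fun t : 'S_N * {set 'I_N} => perm_monom t.1 t.2)
    (enum [pred t | link_perm G i j t.1 t.2]).

Lemma closed_monoms_uniq N (G : rel 'I_N) : uniq (closed_monoms G).
Proof.
rewrite map_inj_in_uniq ?enum_uniq // => s t; rewrite !mem_enum.
exact: cover_perm_monom_inj.
Qed.

Lemma open_monoms_uniq N (G : rel 'I_N) i j : uniq (open_monoms G i j).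
Proof.
rewrite map_inj_in_uniq ?enum_uniq // => s t; rewrite !mem_enum.
exact: link_perm_monom_inj.
Qed.

Lemma closed_monomsP N (G : rel 'I_N) h :
  h \in closed_monoms G <-> self_avoiding_closed G h.
Proof.
rewrite self_avoiding_closedP; split=> [/mapP[[s U]]|[s [U [sU ->]]]].
  by rewrite mem_enum => sU ->; exists s, U.
by apply/mapP; exists (s, U); rewrite // mem_enum.
Qed.

Lemma open_monomsP N (G : rel 'I_N) i j h : i != j ->
  h \in open_monoms G i j <-> self_avoiding_open G i j h.
Proof.
move=> ij; rewrite self_avoiding_openP //; split=> [/mapP[[s U]]|[s [U [sU ->]]]].
  by rewrite mem_enum => sU ->; exists s, U.
by apply/mapP; exists (s, U); rewrite // mem_enum.
Qed.
Lemma sum_perm_monoms N (V : nmodType) (Q : 'S_N -> {set 'I_N} -> bool)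
    (P : pred {cmonom (edge N)}) (f : {cmonom (edge N)} -> V) :
  \sum_(m <- map (fun t : 'S_N * {set 'I_N} => perm_monom t.1 t.2)
               (enum [pred t | Q t.1 t.2]) | P m) f m =
  \sum_s \sum_(U | Q s U && P (perm_monom s U)) f (perm_monom s U).
Proof.
rewrite big_map big_enum_cond /= pair_big_dep /=.
by apply: eq_bigl => t; rewrite inE.
Qed.

Lemma det_sub_edge_mx N (G : rel 'I_N) :
  \det (1 - edge_mx G) =
    \sum_(m <- closed_monoms G) << (-1) ^+ ncc m *g m >>.
Proof.
rewrite sum_perm_monoms /=.
apply: eq_bigr => s _; rewrite prod_sub_edge_mx mulr_sumr; apply: eq_big => [U|U].
  rewrite andbT; have -> /= : [forall x in U, predT x] by apply/forall_inP.
  congr (_ && _); apply/forall_inP/fintype.subsetP => [sU x|sU x _].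
    by rewrite inE; apply: contraR => /(implyP (sU x isT)).
  by apply/implyP; apply: contraR => /sU.
case/and3P=> _ /forall_inP sU _; rewrite -malgU_sign perm_sign_cover //.
apply/fintype.subsetP => x; rewrite inE; apply: contraR.
exact: implyP (sU x isT).
Qed.

(** The adjugate transposes: the permutations in its entry [i j] send [j] to [i] and row [j] is
    missing from the product, which is exactly the encoding of open hikes by [link_perm]. *)
Lemma adj_sub_edge_mx_open N (G : rel 'I_N) i j : i != j ->
  \adj (1 - edge_mx G) i j =
    \sum_(m <- open_monoms G i j) << (-1) ^+ ncc' m *g m >>.
Proof.
move=> ij; rewrite mxE expand_cofactor sum_perm_monoms big_mkcond /=.
have condE (s : 'S_N) (U : {set 'I_N}) : (s j == i) && [&& [forall x in U, j != x],
    [forall (x | j != x), (x \notin U) ==> (s x == x)] & [forall x in U, G x (s x)]]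
    = link_perm G i j s U.
  rewrite /link_perm andbCA; congr [&& _, _ & _].
    apply/forall_inP/idP => [Uj|jU x xU]; last by apply: contraNneq jU => ->.
    by apply/negP => /Uj; rewrite eqxx.
  congr (_ && _); apply/forall_inP/fintype.subsetP => [sU x|sU x jx].
    rewrite inE; apply: contraR; rewrite !inE negb_or eq_sym => /andP[jx xU].
    exact: implyP (sU x jx) xU.
  apply/implyP; apply: contraR => /sU; rewrite !inE eq_sym.
  by rewrite (negbTE jx).
apply: eq_bigr => s _; rewrite (eq_bigl _ _ (fun U => andbT _)).
rewrite -(eq_bigl _ _ (condE s)); case: eqP => [sj|_].
  rewrite prod_sub_edge_mx mulr_sumr; apply: eq_bigr => U cU; rewrite -malgU_sign.
  have : link_perm G i j s U by rewrite -condE sj eqxx.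
  by case/and4P=> jU _ sU _; rewrite (@perm_sign_link _ _ _ i j).
by rewrite big_pred0.
Qed.

(** Here the permutations fix [i] and [U] avoids [i], which leaves the closed hikes that miss the
    vertex [i]. *)
Lemma adj_sub_edge_mx_closed N (G : rel 'I_N) i :
  \adj (1 - edge_mx G) i i =
    \sum_(m <- closed_monoms G | i \notin vertices m) << (-1) ^+ ncc m *g m >>.
Proof.
rewrite mxE expand_cofactor sum_perm_monoms big_mkcond /=.
have condE (s : 'S_N) (U : {set 'I_N}) : (s i == i) && [&& [forall x in U, i != x],
    [forall (x | i != x), (x \notin U) ==> (s x == x)] & [forall x in U, G x (s x)]]
    = cover_perm G s U && (i \notin vertices (perm_monom s U)).
  apply/idP/idP.
    case/and4P=> /eqP si /forall_inP Ui /forall_inP sU GU.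
    have iU : i \notin U by apply/negP => /Ui; rewrite eqxx.
    have onU : perm_on U s.
      apply/fintype.subsetP => x; rewrite inE; apply: contraR => xU.
      by have [<-|/sU/implyP->//] := eqVneq i x; rewrite si.
    by rewrite /cover_perm onU GU vertices_cover.
  case/andP=> /andP[onU GU]; rewrite vertices_cover // => iU.
  apply/and4P; split=> //; first by rewrite (out_perm onU iU).
    by apply/forall_inP => x xU; apply: contraNneq iU => ->.
  by apply/forall_inP => x _; apply/implyP => xU; rewrite (out_perm onU xU).
apply: eq_bigr => s _; rewrite -(eq_bigl _ _ (condE s)); case: eqP => [si|_].
  rewrite prod_sub_edge_mx mulr_sumr; apply: eq_bigr => U cU; rewrite -malgU_sign.
  have := condE s U; rewrite si eqxx cU => /esym/andP[/andP[sU _] _].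
  by rewrite perm_sign_cover.
by rewrite big_pred0.
Qed.
Lemma malgU_signS (K : monomType) (R : nzRingType) n (m : K) :
  << (-1) ^+ n.+1 *g m >> = - << (-1 : R) ^+ n *g m >>.
Proof. by rewrite exprS mulN1r monalgUN. Qed.

Definition sign_sum N (E : seq {cmonom (edge N)}) : walk_alg N :=
  \sum_(m <- E) << (-1) ^+ ncc' m *g m >>.

Definition factor_monoms N (G : rel 'I_N) : seq {cmonom (edge N)} :=
  [seq m <- closed_monoms G | m != mone].

Definition last_monoms N (G : rel 'I_N) i j : seq {cmonom (edge N)} :=
  if i == j then [seq m <- closed_monoms G | i \in vertices m]
  else open_monoms G i j.

Lemma last_monoms_uniq N (G : rel 'I_N) i j : uniq (last_monoms G i j).
Proof.
rewrite /last_monoms; case: ifP => _; last exact: open_monoms_uniq.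
by rewrite filter_uniq ?closed_monoms_uniq.
Qed.

Lemma factor_monomsP N (G : rel 'I_N) m :
  m \in factor_monoms G <-> m <> mone /\ self_avoiding_closed G m.
Proof.
rewrite mem_filter -closed_monomsP; split=> [/andP[/eqP]//|[/eqP -> ->//]].
Qed.

Lemma vertices1 N : vertices (mone : {cmonom (edge N)}) = set0.
Proof.
apply/setP => x; rewrite !inE; apply/existsP => -[y].
by rewrite !cm1.
Qed.

Lemma last_monomsP N (G : rel 'I_N) i j m :
  m \in last_monoms G i j <-> self_avoiding_hikes G i j m.
Proof.
rewrite /last_monoms /self_avoiding_hikes /=; case: eqVneq => [_|ij]; last first.
  exact: open_monomsP.
rewrite mem_filter; split=> [/andP[im /closed_monomsP sm]|[_ /closed_monomsP -> ->//]].
by split=> // m1; rewrite m1 vertices1 inE in im.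
Qed.

(** The empty hike contributes the 1 of the determinant; the change of sign of all other terms
    replaces [ncc] by [ncc']. *)
Lemma sub1_det_edge_mx N (G : rel 'I_N) :
  1 - \det (1 - edge_mx G) = sign_sum (factor_monoms G).
Proof.
have c1 : mone \in closed_monoms G.
  by apply/closed_monomsP; exists [::]; split=> //; rewrite /monom_prod big_nil.
rewrite det_sub_edge_mx (bigD1_seq _ c1) ?closed_monoms_uniq //=.
have -> : ncc (mone : {cmonom (edge N)}) = 0%N.
  by rewrite /ncc vertices1; apply: eq_card0 => x; rewrite !inE andbF.
rewrite expr0 opprD addrA subrr add0r -sumrN /sign_sum big_filter.
by apply: eq_bigr => m _; rewrite malgU_signS.
Qed.

(** On the diagonal, the closed hikes missing [i] cancel against the determinant, and those through
    [i] remain with opposite sign. *)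
Lemma adj_edge_mx N (G : rel 'I_N) i j :
  \adj (1 - edge_mx G) i j - (i == j)%:R * \det (1 - edge_mx G) =
    sign_sum (last_monoms G i j).
Proof.
rewrite /last_monoms /sign_sum; case: eqVneq => [<-|ij].
  rewrite adj_sub_edge_mx_closed det_sub_edge_mx mul1r.
  rewrite [X in _ - X](bigID (fun m => i \in vertices m)) /= opprD addrCA subrr addr0.
  rewrite -sumrN big_filter; apply: eq_bigr => m _.
  by rewrite malgU_signS.
by rewrite adj_sub_edge_mx_open // mul0r subr0.
Qed.

(** * Truncated generating functions *)

(** This replaces the order of a power series: [ord_ge d (x - y)] says that [x] and [y] agree in all
    degrees below [d]. *)
Definition ord_ge N d (x : walk_alg N) := forall h, (mdeg h < d)%N -> x@_h = 0.

Lemma ord_geB N d (x y : walk_alg N) : ord_ge d x -> ord_ge d y -> ord_ge d (x - y).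
Proof. by move=> xd yd h hd; rewrite mcoeffB xd ?yd ?subrr. Qed.

Lemma ord_ge_sum N d (I : finType) (P : pred I) (F : I -> walk_alg N) :
  (forall i, P i -> ord_ge d (F i)) -> ord_ge d (\sum_(i | P i) F i).
Proof. by move=> Fd h hd; rewrite raddf_sum big1 // => i Pi; apply: Fd. Qed.

Lemma ord_geM N c d (x y : walk_alg N) :
  ord_ge c x -> ord_ge d y -> ord_ge (c + d) (x * y).
Proof.
move=> xc yd h hd; rewrite mcoeffMl big1 // => m1 _; rewrite big1 // => m2 _.
case: eqP => // mh; rewrite mulr1n.
have [/xc->|cm] := ltnP (mdeg m1) c; first by rewrite mul0r.
rewrite yd ?mulr0 // -(ltn_add2l c) (leq_ltn_trans _ hd) // -mh mdegM.
by rewrite leq_add2r.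
Qed.

Lemma ord_ge_mull N d (x y : walk_alg N) : ord_ge d y -> ord_ge d (x * y).
Proof. by move=> yd; rewrite -[d]add0n; apply: ord_geM. Qed.

Lemma ord_ge_factors N (G : rel 'I_N) : ord_ge 1 (sign_sum (factor_monoms G)).
Proof.
move=> h; rewrite ltnS leqn0 mdeg_eq0 => /eqP ->.
rewrite /sign_sum big_filter raddf_sum big1 // => m m1 /=.
by rewrite mcoeffU (negbTE m1).
Qed.

Lemma mdeg_monom_of N (w : seq (edge N)) : mdeg (monom_of w) = size w.
Proof.
rewrite /monom_of mdeg_prod -sum1_size; apply: eq_bigr => a _; exact: mdegU.
Qed.

Lemma edge_mx_exp N (G : rel 'I_N) l i j :
  (edge_mx G ^+ l) i j =
    \sum_(w : l.-tuple (edge N) | walk G i j w) << monom_of w >>.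
Proof.
elim: l i => [|l IHl] i.
  rewrite expr0 mxE /= big_mkcond (big_pred1 [tuple]) => [|w]; last first.
    by rewrite (tuple0 w) /= eqxx.
  by rewrite /= /monom_of big_nil; case: eqP.
rewrite exprS -mulmxE mxE.
pose cons_t (p : edge N * l.-tuple (edge N)) := [tuple of p.1 :: p.2].
rewrite (reindex cons_t) /=; last first.
  exists (fun t => (thead t, [tuple of behead t])) => [[e w] _|t _].
    by rewrite /cons_t /= theadE; congr (_, _); apply: val_inj.
  by rewrite /cons_t /= -tuple_eta.
transitivity (\sum_(e : edge N | (e.1 == i) && G e.1 e.2)
    \sum_(w : l.-tuple (edge N) | walk G e.2 j w) << monom_of (e :: w) >> : walk_alg N);
  last by rewrite pair_big_dep; apply: eq_bigl => -[e w]; rewrite /= andbA.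
transitivity (\sum_a \sum_(b | (a == i) && G a b)
    \sum_(w : l.-tuple (edge N) | walk G b j w)
      << monom_of ((a, b) :: w) >> : walk_alg N);
  last by rewrite pair_big_dep; apply: eq_bigr => -[].
rewrite [RHS](bigD1 i) //= [X in _ + X]big1 ?addr0 => [|a /negbTE ai]; last first.
  by rewrite ai big_pred0.
rewrite eqxx [RHS]big_mkcond; apply: eq_bigr => b _; rewrite edge_mxE IHl.
case: (G i b); last by rewrite mul0r.
by rewrite mulr_sumr; apply: eq_bigr => w _; rewrite /monom_of big_cons malgUM1.
Qed.
Lemma mcoeff_edge_mx_exp N (G : rel 'I_N) l i j h :
  ((edge_mx G ^+ l) i j)@_h = if l == mdeg h then (walk_count G i j h)%:Z else 0.
Proof.
rewrite edge_mx_exp raddf_sum /=; case: eqP => [->|lh].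
  rewrite /walk_count cardsE -natz -sum1_card natr_sum [RHS]big_mkcondr /=.
  by apply: eq_bigr => w _; rewrite mcoeffU1; case: eqP.
rewrite big1 // => w _; rewrite mcoeffU1; case: eqP => // wh.
by case: lh; rewrite -wh mdeg_monom_of size_tuple.
Qed.

Lemma ord_ge_edge_mx_exp N (G : rel 'I_N) l i j : ord_ge l ((edge_mx G ^+ l) i j).
Proof. by move=> h hl; rewrite mcoeff_edge_mx_exp gtn_eqF. Qed.

(** Since [A *m W = 1 - edge_mx G ^+ n], multiplying by the adjugate gives Cramer's rule up to the
    remainder [\adj A *m edge_mx G ^+ n]. Subtracting the Kronecker delta discards the empty
    walk. *)
Lemma walk_series_eq N (G : rel 'I_N) i j n :
  let A := 1 - edge_mx G in let W := \sum_(l < n) edge_mx G ^+ l in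
  exists2 r, ord_ge n r &
    \det A * (W i j - (i == j)%:R) = sign_sum (last_monoms G i j) - r.
Proof.
move=> A W; exists ((\adj A *m edge_mx G ^+ n) i j).
  by rewrite mxE; apply: ord_ge_sum => k _; apply/ord_ge_mull/ord_ge_edge_mx_exp.
have AW : A *m W = 1 - edge_mx G ^+ n.
  by rewrite -[RHS]opprB subrX1 -mulNr opprB mulmxE.
have /matrixP/(_ i j) : \det A *: W = \adj A *m (1 - edge_mx G ^+ n).
  by rewrite -AW mulmxA mul_adj_mx mul_scalar_mx.
rewrite mulmxBr mulmx1 !mxE -adj_edge_mx => AWij.
have cofE : cofactor A j i = \adj A i j by rewrite mxE.
by rewrite mulrBr AWij [_ * (i == j)%:R]mulrC cofE addrAC.
Qed.

(** * Truncated geometric series and decompositions *)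

Fixpoint lists_upto (T : Type) (S : seq T) n : seq (seq T) :=
  if n is n'.+1 then [::] :: [seq s :: l | s <- S, l <- lists_upto S n']
  else [:: [::]].

Lemma mem_lists_upto (T : eqType) (S : seq T) n l :
  (l \in lists_upto S n) = (size l <= n)%N && all (mem S) l.
Proof.
elim: n l => [|n IHn] [|s l] //=; rewrite ?inE //=.
apply/allpairsP/idP => [[[t l'] /= [tS]]|].
  by rewrite IHn => /andP[ln lS] [-> ->]; rewrite ltnS ln tS.
rewrite ltnS => /and3P[ln sS lS]; exists (s, l); split=> //=.
by rewrite IHn ln.
Qed.

Lemma lists_upto_uniq (T : eqType) (S : seq T) n :
  uniq S -> uniq (lists_upto S n).
Proof.
move=> uS; elim: n => //= n IHn; apply/andP; split.
  by apply/allpairsP => -[[s l] []].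
by rewrite allpairs_uniq // => -[s l] [s' l'] _ _ [-> ->].
Qed.

Definition decomposition_monom N (d : seq {cmonom (edge N)} * {cmonom (edge N)}) :=
  mmul (\big[mmul/mone]_(s <- d.1) s) d.2.

Definition decomposition_weight N (d : seq {cmonom (edge N)} * {cmonom (edge N)}) :=
  ((\sum_(s <- d.1) ncc' s) + ncc' d.2)%N.

(** Horner form of the truncated geometric series [1 + s + ... + s ^+ n] times [sign_sum P], where
    [s = sign_sum S]. *)
Fixpoint decomposition_sum N (S P : seq {cmonom (edge N)}) n : walk_alg N :=
  if n is n'.+1 then sign_sum P + sign_sum S * decomposition_sum S P n'
  else sign_sum P.

Lemma decomposition_sumE N (S P : seq {cmonom (edge N)}) n :
  decomposition_sum S P n =
  \sum_(l <- lists_upto S n) \sum_(p <- P)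
    << (-1) ^+ decomposition_weight (l, p) *g decomposition_monom (l, p) >>.
Proof.
have E0 : sign_sum P = \sum_(p <- P)
    << (-1) ^+ decomposition_weight ([::], p) *g decomposition_monom ([::], p) >>.
  apply: eq_bigr => p _; rewrite /decomposition_weight /decomposition_monom.
  by rewrite !big_nil mul1m.
elim: n => [|n IHn] /=; first by rewrite big_seq1; exact: E0.
rewrite big_cons E0 IHn; congr (_ + _).
rewrite big_allpairs_dep /sign_sum mulr_suml; apply: eq_bigr => s _.
rewrite mulr_sumr; apply: eq_bigr => l _; rewrite mulr_sumr; apply: eq_bigr => p _.
rewrite malgUM -exprD /decomposition_weight /decomposition_monom !big_cons.
by rewrite addnA mulmA.
Qed.

(** The hypothesis reads [x = sign_sum P + sign_sum S * x - r], and the truncated sums are the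
    iterates of this equation without [r]. Each iteration multiplies the error by [sign_sum S],
    which raises its order by one, and [r] only disturbs degrees from [m] on. *)
Lemma ord_ge_decomposition_sum N (S P : seq {cmonom (edge N)}) (x r : walk_alg N) m n :
  ord_ge 1 (sign_sum S) -> ord_ge m r ->
  (1 - sign_sum S) * x = sign_sum P - r -> (n < m)%N ->
  ord_ge n.+1 (x - decomposition_sum S P n).
Proof.
move=> S1 rm; rewrite mulrBl mul1r => /(canRL (subrK _)) xE.
have low k : (k <= m)%N -> ord_ge k r by move=> km h hk; apply/rm/(leq_trans hk).
elim: n => [|n IHn] lt_nm.
  have -> : x - decomposition_sum S P 0 = x * sign_sum S - r.
    by rewrite [in LHS]xE /= addrAC [_ - r]addrC addrK addrC mulrC.
  by apply: ord_geB; [apply: ord_ge_mull|apply: low].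
have -> : x - decomposition_sum S P n.+1 = sign_sum S * (x - decomposition_sum S P n) - r.
  by rewrite [in LHS]xE /= mulrBr opprD addrACA [_ - r]addrC addrK addrC.
apply: ord_geB; last exact: low.
by rewrite -add1n; apply: ord_geM => //; apply/IHn/ltnW.
Qed.

(** * Comparison of the coefficients at [h] *)

Theorem theorem3 (N : nat) (G : rel 'I_N) (i j : 'I_N) (h : {cmonom (edge N)}) :
  h <> mone -> hike G i j h ->
  (walk_count G i j h)%:Z =
    \sum_(d \in decompositions G i j h)
      (-1 : int) ^+ ((\sum_(s <- d.1) ncc' s) + ncc' d.2)%N.
Proof.
move=> h1 _; set S := factor_monoms G; set P := last_monoms G i j.
(* Lengths up to [m] are kept: this includes all walks with monomial [h], and the remainder, of
   order [m.+1], does not reach [h]. *)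
set m := mdeg h; pose x := (\sum_(l < m.+1) edge_mx G ^+ l) i j - (i == j)%:R.
have xh : x@_h = (walk_count G i j h)%:Z.
  rewrite mcoeffB summxE raddf_sum (bigD1 ord_max) //= mcoeff_edge_mx_exp eqxx.
  rewrite big1 => [|l lm]; last first.
    rewrite mcoeff_edge_mx_exp -/m; move: lm; rewrite -val_eqE /=.
    by move=> /negbTE ->.
  (* A constant has coefficient 0 at [h] because [h] is not the empty monomial. *)
  have -> : ((i == j)%:R : walk_alg N)@_h = 0.
    by case: eqP => _; rewrite ?mcoeff0 // mcoeff1; case: eqP.
  by rewrite addr0 subr0.
have [r rm xE] := walk_series_eq G i j m.+1.
have SE : \det (1 - edge_mx G) = 1 - sign_sum S by rewrite -sub1_det_edge_mx subKr.
rewrite SE in xE.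
have := ord_ge_decomposition_sum (ord_ge_factors G) rm xE (ltnSn m).
move=> /(_ h (ltnSn _)); rewrite mcoeffB -/x xh => /eqP; rewrite subr_eq0 => /eqP ->.
pose D := [seq d <- [seq (l, p) | l <- lists_upto S m, p <- P]
            | decomposition_monom d == h].
have uD : uniq D.
  rewrite filter_uniq // allpairs_uniq //.
  - by rewrite lists_upto_uniq // filter_uniq ?closed_monoms_uniq.
  - exact: last_monoms_uniq.
  - by case=> [? ?] [? ?] _ _ [-> ->].
have DE : decompositions G i j h = [set` D]%classic.
  apply/seteqP; split=> [[l p] [/= lS pP lph]|[l p] /=]; last first.
    rewrite mem_filter => /andP[/eqP lph /allpairsP[[l' p'] /= [lS pP [ll pp]]]].
    move: lS pP; rewrite -{}ll -{}pp mem_lists_upto => /andP[_ /allP lS] pP.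
    by split=> //= [s /lS sS|]; [apply/factor_monomsP|apply/last_monomsP].
  rewrite mem_filter; apply/andP; split; first exact/eqP.
  apply/allpairsP; exists (l, p); split=> //=; last exact/last_monomsP.
  rewrite mem_lists_upto; apply/andP; split; last first.
    by apply/allP => s /lS sS; apply/factor_monomsP.
  (* Each factor is non-empty, hence of degree at least 1, so there are at most [m] factors and the
     truncation loses no decomposition. *)
  rewrite /m -lph mdegM mdeg_prod (leq_trans _ (leq_addr _ _)) // -sum1_size.
  rewrite big_seq [leqRHS]big_seq leq_sum // => s /lS[s1 _].
  by rewrite lt0n mdeg_eq0; apply/eqP.
rewrite DE -fsbig_seq // big_filter [RHS]big_mkcond big_allpairs_dep.
rewrite decomposition_sumE raddf_sum; apply: eq_bigr => l _.
by rewrite raddf_sum; apply: eq_bigr => p _; rewrite /= mcoeffU mulrb.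
Qed.
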